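(* Let $\mathcal A$ be an abelian length category and let $Q$ be an indecomposable object of $\mathcal A$. Then $Q$ is injective if and only if there is a length function $\ell$ on $\mathcal A$ such that $\ell^*(X)\leq\ell^*(Q)$ for all $X\in\operatorname{ind}\mathcal A$.
   Context: An abelian length category is an abelian category in which every object has finite length and in which the isomorphism classes of objects form a set. A length function on $\mathcal A$ is a map $\ell$ sending each object $X\in\mathcal A$ to a real number $\ell(X)\geq 0$ such that $\ell(X)=0$ if and only if $X=0$, and $\ell(X)=\ell(X')+\ell(X'')$ for every exact sequence $0\to X'\to X\to X''\to 0$. The set $\operatorname{ind}\mathcal A$ of isomorphism classes of indecomposable objects is partially ordered by the subobject relation: $X\subseteq Y$ if there is a monomorphism $X\to Y$; we write $X\subset Y$ if $X\subseteq Y$ and $X\neq Y$ in $\operatorname{ind}\mathcal A$. Let $\operatorname{Ch}(\mathbb R)$ be the set of finite subsets of $\mathbb R$ with the lexicographic order: $A\leq B$ if and only if $\min(B\setminus A)\leq\min(A\setminus B)$, with the convention $r<\min\emptyset$ for all $r\in\mathbb R$. This is a total order. The Gabriel-Roiter measure of $\mathcal A$ with respect to $\ell$ is the map $\ell^*\colon\operatorname{ind}\mathcal A\to\operatorname{Ch}(\mathbb R)$, $$\ell^*(X)=\max\bigl\{\{\ell(X_1),\ldots,\ell(X_n)\}\ \big|\ n\geq 1,\ X_1\subset X_2\subset\cdots\subset X_n=X\text{ a chain in }\operatorname{ind}\mathcal A\bigr\},$$ the maximum being taken with respect to the lexicographic order (it exists). *)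

(* Defs.v *)
From HB Require Import structures.
From mathcomp Require Import all_boot all_order all_algebra finmap.
From mathcomp Require Import boolp classical_sets reals constructive_ereal.

Set Implicit Arguments.
Unset Strict Implicit.
Unset Printing Implicit Defensive.

Import Order.TTheory GRing.Theory Num.Theory.

Local Open Scope ring_scope.

(** * Abelian length categories *)

Reserved Notation "g \after f" (at level 40, left associativity).

(* Categories enriched over abelian groups. *)
Record preadditive := Preadditive {
  obj :> Type;
  hom : obj -> obj -> zmodType;
  idm : forall X, hom X X;
  comp : forall X Y Z, hom Y Z -> hom X Y -> hom X Z;
  comp_idl : forall X Y (f : hom X Y), comp (idm Y) f = f;
  comp_idr : forall X Y (f : hom X Y), comp f (idm X) = f;
  compA : forall W X Y Z (h : hom Y Z) (g : hom X Y) (f : hom W X),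
    comp h (comp g f) = comp (comp h g) f;
  compDl : forall X Y Z (g g' : hom Y Z) (f : hom X Y),
    comp (g + g') f = comp g f + comp g' f;
  compDr : forall X Y Z (g : hom Y Z) (f f' : hom X Y),
    comp g (f + f') = comp g f + comp g f'
}.

Arguments hom {p} _ _ : rename.
Arguments idm {p} _ : rename.
Arguments comp {p X Y Z} _ _ : rename.

Notation "g \after f" := (comp g f) : ring_scope.

Section Preadditive.
Variable A : preadditive.
Implicit Types W X Y Z : A.

Definition is_mono X Y (f : hom X Y) : Prop :=
  forall W (g h : hom W X), f \after g = f \after h -> g = h.

Definition is_epi X Y (f : hom X Y) : Prop :=
  forall Z (g h : hom Y Z), g \after f = h \after f -> g = h.

Definition is_iso X Y (f : hom X Y) : Prop :=
  exists g : hom Y X, g \after f = idm X /\ f \after g = idm Y.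

Definition isomorphic X Y : Prop := exists f : hom X Y, is_iso f.

(* Each hom-set contains 0, so this says that Z is initial and terminal. *)
Definition is_zero Z : Prop :=
  forall X, (forall f : hom Z X, f = 0) /\ (forall f : hom X Z, f = 0).

Definition is_biproduct X Y Z : Prop :=
  exists (i1 : hom X Z) (i2 : hom Y Z) (p1 : hom Z X) (p2 : hom Z Y),
    [/\ p1 \after i1 = idm X, p2 \after i2 = idm Y,
        p1 \after i2 = 0, p2 \after i1 = 0
      & i1 \after p1 + i2 \after p2 = idm Z].

Definition is_kernel K X Y (f : hom X Y) (k : hom K X) : Prop :=
  f \after k = 0 /\
  forall W (g : hom W X), f \after g = 0 -> exists! u : hom W K, k \after u = g.

Definition is_cokernel X Y C (f : hom X Y) (c : hom Y C) : Prop :=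
  c \after f = 0 /\
  forall Z (g : hom Y Z), g \after f = 0 -> exists! u : hom C Z, u \after c = g.

Definition short_exact X' X X'' (i : hom X' X) (p : hom X X'') : Prop :=
  is_kernel p i /\ is_cokernel i p.

Definition is_abelian : Prop :=
  (exists Z, is_zero Z) /\
  (forall X Y, exists Z, is_biproduct X Y Z) /\
  (forall X Y (f : hom X Y), exists K (k : hom K X), is_kernel f k) /\
  (forall X Y (f : hom X Y), exists C (c : hom Y C), is_cokernel f c) /\
  (forall X Y (f : hom X Y), is_mono f ->
     exists Z (g : hom Y Z), is_kernel g f) /\
  (forall X Y (f : hom X Y), is_epi f ->
     exists Z (g : hom Z X), is_cokernel g f).

Definition is_simple S : Prop :=
  ~ is_zero S /\
  forall X (f : hom X S), is_mono f -> is_zero X \/ is_iso f.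

(* Existence of a composition series, built up by successive extensions with
   simple quotients. *)
Inductive finite_length : A -> Prop :=
| finite_length0 X : is_zero X -> finite_length X
| finite_lengthS X' X S (i : hom X' X) (p : hom X S) :
    finite_length X' -> short_exact i p -> is_simple S -> finite_length X.

(* The universe of I is unrelated to that of the objects, so the objects may
   form a proper class relative to it. *)
Definition essentially_small : Prop :=
  exists (I : Type) (r : I -> A), forall X, exists i, isomorphic X (r i).

Definition abelian_length : Prop :=
  [/\ is_abelian, forall X, finite_length X & essentially_small].

Definition indecomposable X : Prop :=
  ~ is_zero X /\
  forall X1 X2, is_biproduct X1 X2 X -> is_zero X1 \/ is_zero X2.

Definition injective_object Q : Prop :=
  forall X Y (m : hom X Y) (f : hom X Q), is_mono m ->
    exists g : hom Y Q, g \after m = f.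

(* The strict relation on isomorphism classes, read on representatives. *)
Definition proper_sub X Y : Prop :=
  (exists f : hom X Y, is_mono f) /\ ~ isomorphic X Y.

End Preadditive.

(** * Lexicographic order on finite sets of reals *)

Section Chains.
Variable R : realType.

Definition ch_min (A : {fset R}) : \bar R :=
  \big[Order.min/+oo%E]_(x <- enum_fset A) x%:E.

Definition ch_le (A B : {fset R}) : Prop :=
  (ch_min (B `\` A)%fset <= ch_min (A `\` B)%fset)%E.

End Chains.

(** * Length functions and the Gabriel-Roiter measure *)

Section GabrielRoiter.
Variables (R : realType) (A : preadditive).

Definition length_function (l : A -> R) : Prop :=
  [/\ forall X, 0 <= l X,
      forall X, l X = 0 <-> is_zero X
    & forall X' X X'' (i : hom X' X) (p : hom X X''),
        short_exact i p -> l X = l X' + l X''].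

Variable l : A -> R.

(* Indices run from 0 to n: a chain with n.+1 members. *)
Definition ind_chain (X : A) (n : nat) (c : nat -> A) : Prop :=
  [/\ forall i, (i <= n)%N -> indecomposable (c i),
      forall i, (i < n)%N -> proper_sub (c i) (c i.+1)
    & c n = X].

Definition chain_values (X : A) : set {fset R} :=
  [set V | exists (n : nat) (c : nat -> A),
     ind_chain X n c /\ V = [fset l (c (val i)) | i in 'I_n.+1]%fset].

(* The maximum of chain_values X for ch_le, which exists and is unique when l is
   a length function and X is an indecomposable object of finite length; the
   default fset0 only serves to make the function total. *)
Definition gr_measure (X : A) : {fset R} :=
  xget fset0 [set V | chain_values X V /\
                      forall W, chain_values X W -> ch_le W V].

End GabrielRoiter.

(* Main.v *)
(* If Q is injective, choose a simple subobject S of Q and give S length 1 and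
   every other simple object length 2, so that chains not starting with S are
   lexicographically smaller than {l(S), l(Q)}. In a chain X_1 < ... < X_n starting
   with S let X_i be the first term, if any, that does not embed into Q. An
   embedding of X_(i-1) extends to X_i -> Q, whose image Y is indecomposable and
   satisfies l(X_(i-1)) < l(Y) < l(X_i), so X_1 < ... < X_(i-1) < Y <= Q is a
   lexicographically larger chain.

   Conversely, for any l and any indecomposable X there is a nonzero g : W -> X
   killed by every morphism X -> Z that is not a split monomorphism, where Z is
   indecomposable of measure at most that of X. If the measure of Q is maximal,
   then for a monomorphism n : Q -> P some component Q -> Z of n does not kill
   this g, so it splits, and so does n. *)
From mathcomp Require Import all_boot all_order all_algebra finmap.
From mathcomp Require Import boolp classical_sets reals constructive_ereal.
(* Imported last: [hom] and [comp] also name constants of MathComp. *)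
Require Import Defs.

Set Implicit Arguments.
Unset Strict Implicit.
Unset Printing Implicit Defensive.

Import Order.TTheory GRing.Theory Num.Theory.

Local Open Scope ring_scope.

(** * Abelian categories *)

Section Preadditive.
Variable A : preadditive.
Implicit Types W X Y Z : A.

Lemma comp0l X Y Z (f : hom X Y) : (0 : hom Y Z) \after f = 0.
Proof. by apply: (addrI (0 \after f)); rewrite -compDl !addr0. Qed.

Lemma comp0r X Y Z (g : hom Y Z) : g \after (0 : hom X Y) = 0.
Proof. by apply: (addrI (g \after 0)); rewrite -compDr !addr0. Qed.

Lemma compNl X Y Z (g : hom Y Z) (f : hom X Y) : (- g) \after f = - (g \after f).
Proof. by apply: (addrI (g \after f)); rewrite -compDl !subrr comp0l. Qed.

Lemma compNr X Y Z (g : hom Y Z) (f : hom X Y) : g \after (- f) = - (g \after f).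
Proof. by apply: (addrI (g \after f)); rewrite -compDr !subrr comp0r. Qed.

Lemma monoP X Y (f : hom X Y) :
  is_mono f <-> forall W (g : hom W X), f \after g = 0 -> g = 0.
Proof.
split=> [mf W g fg0 | f0 W g h fgh]; first by apply: mf; rewrite fg0 comp0r.
by apply/subr0_eq/f0; rewrite compDr compNr fgh subrr.
Qed.

Lemma epiP X Y (f : hom X Y) :
  is_epi f <-> forall Z (g : hom Y Z), g \after f = 0 -> g = 0.
Proof.
split=> [ef W g gf0 | f0 W g h ghf]; first by apply: ef; rewrite gf0 comp0l.
by apply/subr0_eq/f0; rewrite compDl compNl ghf subrr.
Qed.

Lemma mono_comp X Y Z (g : hom Y Z) (f : hom X Y) :
  is_mono g -> is_mono f -> is_mono (g \after f).
Proof. by move=> mg mf W u v; rewrite -!compA => /mg/mf. Qed.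

Lemma epi_comp X Y Z (g : hom Y Z) (f : hom X Y) :
  is_epi g -> is_epi f -> is_epi (g \after f).
Proof. by move=> eg ef W u v; rewrite !compA => /ef/eg. Qed.

Lemma mono_of_comp X Y Z (g : hom Y Z) (f : hom X Y) :
  is_mono (g \after f) -> is_mono f.
Proof. by move=> mgf W u v fuv; apply: mgf; rewrite -!compA fuv. Qed.

Lemma epi_of_comp X Y Z (g : hom Y Z) (f : hom X Y) :
  is_epi (g \after f) -> is_epi g.
Proof. by move=> egf W u v guv; apply: egf; rewrite !compA guv. Qed.

Lemma mono_idm X : is_mono (idm X).
Proof. by move=> W g h; rewrite !comp_idl. Qed.

Lemma split_mono X Y (f : hom X Y) (r : hom Y X) :
  r \after f = idm X -> is_mono f.
Proof. by move=> rf; apply: (@mono_of_comp _ _ _ r); rewrite rf; apply: mono_idm. Qed.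

Lemma iso_mono X Y (f : hom X Y) : is_iso f -> is_mono f.
Proof. by case=> g [gf _]; apply: split_mono gf. Qed.

Lemma iso_epi X Y (f : hom X Y) : is_iso f -> is_epi f.
Proof. by case=> g [_ fg] W u v /(congr1 (comp^~ g)); rewrite -!compA fg !comp_idr. Qed.

Lemma iso_comp X Y Z (g : hom Y Z) (f : hom X Y) :
  is_iso g -> is_iso f -> is_iso (g \after f).
Proof.
case=> g' [g'g gg'] [f' [f'f ff']]; exists (f' \after g'); split.
  by rewrite compA -(compA f') g'g comp_idr.
by rewrite compA -(compA g) ff' comp_idr.
Qed.

Lemma isomorphic_refl X : isomorphic X X.
Proof. by exists (idm X), (idm X); rewrite comp_idl. Qed.

Lemma isomorphic_sym X Y : isomorphic X Y -> isomorphic Y X.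
Proof. by case=> f [g [gf fg]]; exists g, f. Qed.

Lemma isomorphic_trans X Y Z : isomorphic X Y -> isomorphic Y Z -> isomorphic X Z.
Proof. by case=> f isof [g isog]; exists (g \after f); apply: iso_comp. Qed.

Lemma is_zeroP X : is_zero X <-> idm X = 0.
Proof.
split=> [/(_ X)[fX0 _] | id0 Y]; first exact: fX0.
split=> f.
  by rewrite -(comp_idr f) id0 comp0r.
by rewrite -(comp_idl f) id0 comp0l.
Qed.

Lemma mono_zero X Y (f : hom X Y) : is_mono f -> is_zero Y -> is_zero X.
Proof.
by move=> mf /is_zeroP Y0; apply/is_zeroP/mf; rewrite comp_idr comp0r -(comp_idl f) Y0 comp0l.
Qed.

Lemma epi_zero X Y (f : hom X Y) : is_epi f -> is_zero X -> is_zero Y.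
Proof.
by move=> ef /is_zeroP X0; apply/is_zeroP/ef; rewrite comp_idl comp0l -(comp_idr f) X0 comp0r.
Qed.

Lemma kernel_mono K X Y (f : hom X Y) (k : hom K X) : is_kernel f k -> is_mono k.
Proof.
case=> fk0 lift W g h kgh.
have [|u [_ uniq_u]] := lift W (k \after g); first by rewrite compA fk0 comp0l.
by rewrite -(uniq_u g) // -(uniq_u h).
Qed.

Lemma cokernel_epi X Y C (f : hom X Y) (c : hom Y C) : is_cokernel f c -> is_epi c.
Proof.
case=> cf0 desc W g h gch.
have [|u [_ uniq_u]] := desc W (g \after c); first by rewrite -compA cf0 comp0r.
by rewrite -(uniq_u g) // -(uniq_u h).
Qed.

Lemma kernel_lift K X Y (f : hom X Y) (k : hom K X) W (g : hom W X) :
  is_kernel f k -> f \after g = 0 -> exists u, k \after u = g.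
Proof. by case=> _ lift /lift[u []]; exists u. Qed.

Lemma cokernel_desc X Y C (f : hom X Y) (c : hom Y C) Z (g : hom Y Z) :
  is_cokernel f c -> g \after f = 0 -> exists u, u \after c = g.
Proof. by case=> _ desc /desc[u []]; exists u. Qed.

Lemma kernel_intro K X Y (f : hom X Y) (k : hom K X) :
    is_mono k -> f \after k = 0 ->
    (forall W (g : hom W X), f \after g = 0 -> exists u, k \after u = g) ->
  is_kernel f k.
Proof.
move=> mk fk0 lift; split=> // W g /lift[u ku]; exists u; split=> // v kv.
by apply: mk; rewrite ku kv.
Qed.

Lemma cokernel_intro X Y C (f : hom X Y) (c : hom Y C) :
    is_epi c -> c \after f = 0 ->
    (forall Z (g : hom Y Z), g \after f = 0 -> exists u, u \after c = g) ->
  is_cokernel f c.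
Proof.
move=> ec cf0 desc; split=> // W g /desc[u uc]; exists u; split=> // v vc.
by apply: ec; rewrite uc vc.
Qed.

Lemma exact_mono X' X X'' (i : hom X' X) (p : hom X X'') : short_exact i p -> is_mono i.
Proof. by case=> /kernel_mono. Qed.

Lemma exact_epi X' X X'' (i : hom X' X) (p : hom X X'') : short_exact i p -> is_epi p.
Proof. by case=> _ /cokernel_epi. Qed.

Lemma exact_comp0 X' X X'' (i : hom X' X) (p : hom X X'') :
  short_exact i p -> p \after i = 0.
Proof. by case=> -[]. Qed.

Lemma simple_indecomposable X : is_simple X -> indecomposable X.
Proof.
case=> nzX simX; split=> // X1 X2 [i1 [i2 [p1 [p2 [p1i1 p2i2 p1i2 _ _]]]]].
have [X1_0|isoi1] := simX _ i1 (split_mono p1i1); first by left.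
right; apply/is_zeroP; rewrite -p2i2.
suff -> : i2 = 0 by rewrite comp0r.
case: isoi1 => j [ji1 i1j].
have jp : j = p1 by rewrite -(comp_idl j) -p1i1 -compA i1j comp_idr.
by rewrite -(comp_idl i2) -i1j jp -compA p1i2 comp0r.
Qed.

Hypothesis abA : is_abelian A.

Lemma biproduct_exists X Y : exists Z, is_biproduct X Y Z.
Proof. by case: abA => _ []. Qed.

Lemma kernel_exists X Y (f : hom X Y) : exists K (k : hom K X), is_kernel f k.
Proof. by case: abA => _ [_ []]. Qed.

Lemma cokernel_exists X Y (f : hom X Y) : exists C (c : hom Y C), is_cokernel f c.
Proof. by case: abA => _ [_ [_ []]]. Qed.

Lemma mono_cokernel_exact X Y C (f : hom X Y) (c : hom Y C) :
  is_mono f -> is_cokernel f c -> short_exact f c.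
Proof.
move=> mf cokc; split=> //; have [cf0 _] := cokc.
case: abA => _ [_ [_ [_ [/(_ _ _ f mf)[Z [g kg]] _]]]].
have [h hc] := cokernel_desc cokc (proj1 kg).
apply: kernel_intro => // W u cu; apply: (kernel_lift kg).
by rewrite -hc -compA cu comp0r.
Qed.

Lemma epi_kernel_exact K X Y (k : hom K X) (f : hom X Y) :
  is_epi f -> is_kernel f k -> short_exact k f.
Proof.
move=> ef kk; split=> //; have [fk0 _] := kk.
case: abA => _ [_ [_ [_ [_ /(_ _ _ f ef)[Z [g cg]]]]]].
have [h kh] := kernel_lift kk (proj1 cg).
apply: cokernel_intro => // W u uk; apply: (cokernel_desc cg).
by rewrite -kh compA uk comp0l.
Qed.

Lemma mono_short_exact X Y (f : hom X Y) :
  is_mono f -> exists C (c : hom Y C), short_exact f c.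
Proof.
move=> mf; have [C [c cokc]] := cokernel_exists f.
by exists C, c; apply: mono_cokernel_exact.
Qed.

Lemma epi_short_exact X Y (f : hom X Y) :
  is_epi f -> exists K (k : hom K X), short_exact k f.
Proof.
move=> ef; have [K [k kk]] := kernel_exists f.
by exists K, k; apply: epi_kernel_exact.
Qed.

Lemma mono_epi_iso X Y (f : hom X Y) : is_mono f -> is_epi f -> is_iso f.
Proof.
move=> mf ef; have [C [c exfc]] := mono_short_exact mf.
have [|g fg] := @kernel_lift _ _ _ _ _ _ (idm Y) (proj1 exfc).
  by rewrite comp_idr; apply: ef; rewrite comp0l; apply: exact_comp0 exfc.
exists g; split=> //; apply: mf.
by rewrite compA fg comp_idl comp_idr.
Qed.

(** The image is the kernel of the cokernel [c]. If [g] kills [e], then [f] factors through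
    [m \after k], where [k] is the kernel of [g]; the cokernel of that mono kills [f], hence [m], so
    [k] has a right inverse and [g] is zero. *)
Lemma image_exists X Y (f : hom X Y) :
  exists I (m : hom I Y) (e : hom X I), [/\ is_mono m, is_epi e & m \after e = f].
Proof.
have [C [c cokc]] := cokernel_exists f; have [cf0 _] := cokc.
have [I [m kerm]] := kernel_exists c; have mm := kernel_mono kerm.
have [e me] := kernel_lift kerm cf0.
exists I, m, e; split=> //; apply/epiP => Z g ge0.
have [K [k kerk]] := kernel_exists g.
have [e' ke'] := kernel_lift kerk ge0.
have [D [d exmk]] := mono_short_exact (mono_comp mm (kernel_mono kerk)).
have df0 : d \after f = 0.
  by rewrite -me -ke' !compA -(compA d) (exact_comp0 exmk) comp0l.
have [h hc] := cokernel_desc cokc df0.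
have [|u mku] := @kernel_lift _ _ _ _ _ _ m (proj1 exmk).
  by rewrite -hc -compA (proj1 kerm) comp0r.
have ku : k \after u = idm I by apply: mm; rewrite compA mku comp_idr.
by rewrite -(comp_idr g) -ku compA (proj1 kerk) comp0l.
Qed.

Lemma simple_epi X S (f : hom X S) : is_simple S -> f <> 0 -> is_epi f.
Proof.
move=> [_ simS] nz_f; have [I [m [e [mm ee mef]]]] := image_exists f.
have [/(_ S)[I0 _]|isom] := simS _ m mm.
  by case: nz_f; rewrite -mef (I0 m) comp0l.
by rewrite -mef; apply: epi_comp (iso_epi isom) ee.
Qed.

(** [g \after p2] kills the kernel of the difference map [f] on the biproduct, so it equals
    [h \after f]; restricting to [X] gives [h \after p = 0], whence [h = 0] and [g = 0]. *)
Lemma pullback_epi P X Y Z (p : hom X Z) (v : hom Y Z) (x : hom P X) (y : hom P Y) :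
    is_epi p ->
    (forall W (a : hom W X) (b : hom W Y), p \after a = v \after b ->
       exists u, x \after u = a /\ y \after u = b) ->
  is_epi y.
Proof.
move=> ep pull; apply/epiP => T g gy0.
have [B [i1 [i2 [p1 [p2 [p1i1 p2i2 p1i2 p2i1 idB]]]]]] := biproduct_exists X Y.
pose f := p \after p1 - v \after p2.
have fi1 : f \after i1 = p.
  by rewrite compDl compNl -!compA p1i1 p2i1 comp_idr comp0r subr0.
have ef : is_epi f by apply: (@epi_of_comp _ _ _ _ i1); rewrite fi1.
have [K [k exkf]] := epi_short_exact ef.
have [|u [_ yu]] := pull _ (p1 \after k) (p2 \after k).
  apply/subr0_eq; rewrite !compA -compNl -compDl.
  exact: exact_comp0 exkf.
have [|h hf] := @cokernel_desc _ _ _ _ _ _ (g \after p2) (proj2 exkf).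
  by rewrite -compA -yu compA gy0 comp0l.
have h0 : h = 0.
  by apply: ep; rewrite -fi1 compA hf -compA p2i1 comp0l comp0r.
by rewrite -(comp_idr g) -p2i2 compA -hf h0 !comp0l.
Qed.

(** [P] is the cokernel of [(f, - m)] into the biproduct of [Q] and [Y]; a map into [Q] killed in
    [P] comes from a map into [X] killed by [m]. *)
Lemma pushout_mono X Y Q (m : hom X Y) (f : hom X Q) : is_mono m ->
  exists P (n : hom Q P) (g : hom Y P), is_mono n /\ g \after m = n \after f.
Proof.
move=> mm.
have [B [i1 [i2 [p1 [p2 [p1i1 p2i2 p1i2 p2i1 idB]]]]]] := biproduct_exists Q Y.
pose d := i1 \after f - i2 \after m.
have p2d : p2 \after d = - m.
  by rewrite compDr compNr !compA p2i1 p2i2 comp_idl comp0l sub0r.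
have p1d : p1 \after d = f.
  by rewrite compDr compNr !compA p1i1 p1i2 comp_idl comp0l subr0.
have md : is_mono d.
  apply: (@mono_of_comp _ _ _ p2); rewrite p2d; apply/monoP => W g.
  by rewrite compNl => /eqP; rewrite oppr_eq0 => /eqP mg; apply: mm; rewrite mg comp0r.
have [P [c exdc]] := mono_short_exact md.
exists P, (c \after i1), (c \after i2); split; last first.
  apply/esym/subr0_eq; rewrite -!compA -compNr -compDr.
  exact: exact_comp0 exdc.
apply/monoP => W g; rewrite -compA => cg0.
have [u du] := kernel_lift (proj1 exdc) cg0.
have u0 : u = 0.
  apply: mm; apply/oppr_inj; rewrite -compNl -p2d -compA du compA p2i1.
  by rewrite comp0l comp0r oppr0.
by rewrite -(comp_idl g) -p1i1 -compA -du u0 !comp0r.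
Qed.

Lemma kernel_zero_mono K X Y (f : hom X Y) (k : hom K X) :
  is_kernel f k -> is_zero K -> is_mono f.
Proof.
move=> kerk /[dup] K0 /(_ X)[kX0 _]; apply/monoP => W g fg0.
by have [u <-] := kernel_lift kerk fg0; rewrite (kX0 k) comp0l.
Qed.

Lemma cokernel_zero_epi X Y C (f : hom X Y) (c : hom Y C) :
  is_cokernel f c -> is_zero C -> is_epi f.
Proof.
move=> cokc /[dup] C0 /(_ Y)[_ cY0]; apply/epiP => W g gf0.
by have [u <-] := cokernel_desc cokc gf0; rewrite (cY0 c) comp0r.
Qed.

(* The idempotent [s \after r] splits Q off as I and the kernel of r. *)
Lemma indecomposable_retract (I Q : A) (s : hom I Q) (r : hom Q I) :
  indecomposable Q -> ~ is_zero I -> r \after s = idm I -> is_iso s.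
Proof.
case=> _ decQ nzI rs; have [K [k kerk]] := kernel_exists r.
have [q kq] : exists q, k \after q = idm Q - s \after r.
  apply: (kernel_lift kerk).
  by rewrite compDr compNr comp_idr compA rs comp_idl subrr.
have mk := kernel_mono kerk; have [rk0 _] := kerk.
have [|//|K0] := decQ I K.
  exists s, k, r, q; split=> //; last by rewrite kq addrC subrK.
    by apply: mk; rewrite compA kq comp_idr compDl compNl -compA rk0 comp0r subr0 comp_idl.
  by apply: mk; rewrite compA kq comp0r compDl compNl -compA rs comp_idl comp_idr subrr.
exists r; split=> //; have [_ q0] := K0 Q.
by apply/esym/subr0_eq; rewrite -kq (q0 q) comp0r.
Qed.

End Preadditive.

(** * Additive functions from weights of simple objects *)

Section Weight.
Variables (A : preadditive) (abA : is_abelian A) (w : A -> nat).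
Implicit Types X Y S : A.

(** The sum of the weights of the factors of some composition series. It is a relation because
    independence of the series is proved only later, in [has_weight_uniq]. *)
Inductive has_weight : A -> nat -> Prop :=
| has_weight0 X : is_zero X -> has_weight X 0
| has_weightS X' X S (i : hom X' X) (p : hom X S) n :
    has_weight X' n -> short_exact i p -> is_simple S -> has_weight X (n + w S).

Lemma has_weight_exists X : finite_length X -> exists n, has_weight X n.
Proof.
elim=> [Z Z0|X' Y S i p _ [n Xn] exip simS]; first by exists 0%N; apply: has_weight0.
by exists (n + w S)%N; apply: has_weightS Xn exip simS.
Qed.

Lemma has_weight_zero X n : has_weight X n -> is_zero X -> n = 0%N.
Proof.
case=> // X' Y S i p k _ /exact_epi ep [nzS _] Y0.
by case: nzS; apply: epi_zero ep Y0.
Qed.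

(** A composition series of [X] induces series of [X'] and [X'']; its top factor [S] goes to [X'']
    if [X'] lies in the kernel of the map onto [S], and to [X'] otherwise. *)
Lemma has_weight_exact X n : has_weight X n ->
  forall X' X'' (i : hom X' X) (p : hom X X''), short_exact i p ->
  exists a b, [/\ has_weight X' a, has_weight X'' b & n = (a + b)%N].
Proof.
elim=> {X n} [X X0|Y X S j q n Yn IH exjq simS] X' X'' i p exip.
  exists 0%N, 0%N; split=> //; apply: has_weight0.
    exact: mono_zero (exact_mono exip) X0.
  exact: epi_zero (exact_epi exip) X0.
have mj := exact_mono exjq; have eq_ := exact_epi exjq.
have mi := exact_mono exip; have ep := exact_epi exip.
have pi0 := exact_comp0 exip; have qj0 := exact_comp0 exjq.
have [qi0|nz_qi] := EM (q \after i = 0).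
  (* Here [X'] lies in [Y]; [C], the kernel of [X'' -> S], plays the role of [Y / X']. *)
  have [u ju] := kernel_lift (proj1 exjq) qi0.
  have [t tp] := cokernel_desc (proj2 exip) qi0.
  have et : is_epi t by apply: (@epi_of_comp _ _ _ _ _ p); rewrite tp.
  have [C [v exvt]] := epi_short_exact abA et.
  have mv := exact_mono exvt.
  have [|c vc] := @kernel_lift _ _ _ _ _ _ _ (p \after j) (proj1 exvt).
    by rewrite compA tp.
  have ec : is_epi c.
    apply: (pullback_epi abA (v := v) (x := j) ep) => W a b pa.
    have [|y jy] := @kernel_lift _ _ _ _ _ _ _ a (proj1 exjq).
      by rewrite -tp -compA pa compA (exact_comp0 exvt) comp0l.
    by exists y; split=> //; apply: mv; rewrite compA vc -compA jy.
  have keru : is_kernel c u.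
    apply: kernel_intro => [||W g cg0].
    - by apply: (@mono_of_comp _ _ _ _ j); rewrite ju.
    - by apply: mv; rewrite compA vc -compA ju pi0 comp0r.
    have [|h ih] := @kernel_lift _ _ _ _ _ _ _ (j \after g) (proj1 exip).
      by rewrite compA -vc -compA cg0 comp0r.
    by exists h; apply: mj; rewrite compA ju.
  have [a [b [X'a Cb ->]]] := IH _ _ _ _ (epi_kernel_exact abA ec keru).
  by exists a, (b + w S)%N; split=> //; [apply: has_weightS Cb exvt simS|rewrite addnA].
(* Here [X'] maps onto [S]; [K] is the intersection of [X'] and [Y], and [X''] is also the quotient
   of [Y] by [K]. *)
have eqi := simple_epi abA simS nz_qi.
have [K [a exa]] := epi_short_exact abA eqi.
have [|b jb] := @kernel_lift _ _ _ _ _ _ _ (i \after a) (proj1 exjq).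
  by rewrite compA (exact_comp0 exa).
have mb : is_mono b.
  by apply: (@mono_of_comp _ _ _ _ j); rewrite jb; apply: mono_comp mi (exact_mono exa).
have kerb : is_kernel (p \after j) b.
  apply: kernel_intro => // [|W g pjg].
    by rewrite -compA jb compA pi0 comp0l.
  have [|h ih] := @kernel_lift _ _ _ _ _ _ _ (j \after g) (proj1 exip).
    by rewrite compA.
  have [|k ak] := @kernel_lift _ _ _ _ _ _ _ h (proj1 exa).
    by rewrite -compA ih compA qj0 comp0l.
  by exists k; apply: mj; rewrite compA jb -compA ak.
have epj : is_epi (p \after j).
  apply/epiP => Z g gpj.
  have [|h hq] := @cokernel_desc _ _ _ _ _ _ _ (g \after p) (proj2 exjq).
    by rewrite -compA.
  have h0 : h = 0.
    by apply: eqi; rewrite compA hq -compA pi0 comp0l comp0r.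
  by apply: ep; rewrite -hq h0 !comp0l.
have [c [d [Kc X''d ->]]] := IH _ _ _ _ (epi_kernel_exact abA epj kerb).
exists (c + w S)%N, d; split=> //; first exact: has_weightS Kc exa simS.
by rewrite addnAC.
Qed.

Hypothesis w_iso : forall X Y, isomorphic X Y -> w X = w Y.

Lemma has_weight_simple S n : is_simple S -> has_weight S n -> n = w S.
Proof.
move=> simS Sn; case: Sn simS => [X X0 [] //|X' X T i p k X'k exip [nzT _] [nzX simX]].
have [X'0|/iso_epi ei] := simX _ i (exact_mono exip).
  rewrite (has_weight_zero X'k X'0); apply/esym/w_iso.
  exists p; apply: (mono_epi_iso abA) (exact_epi exip).
  exact: kernel_zero_mono (proj1 exip) X'0.
case: nzT; have p0 : p = 0 by apply: ei; rewrite (exact_comp0 exip) comp0l.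
by apply/is_zeroP/(exact_epi exip); rewrite p0 !comp0r.
Qed.

(** Jordan-Hoelder: the second series is split along the top step of the first, and the two pieces
    are compared separately. *)
Lemma has_weight_uniq X n m : has_weight X n -> has_weight X m -> n = m.
Proof.
move=> Xn; elim: Xn m => {X n} [X X0 m Xm|X' X S i p n _ IH exip simS m Xm].
  by rewrite (has_weight_zero Xm X0).
have [a [b [X'a Sb ->]]] := has_weight_exact Xm exip.
by rewrite (IH a X'a) (has_weight_simple simS Sb).
Qed.

Hypothesis fin : forall X, finite_length X.
Hypothesis w_gt0 : forall X, (0 < w X)%N.

Lemma weight_length : exists l : A -> nat,
  [/\ forall X, l X = 0%N <-> is_zero X,
      forall X' X X'' (i : hom X' X) (p : hom X X''),
        short_exact i p -> l X = (l X' + l X'')%N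
    & forall S, is_simple S -> l S = w S].
Proof.
have [l lP] := choice (fun X => has_weight_exists (fin X)).
exists l; split=> [X|X' X X'' i p exip|S simS]; last exact: has_weight_simple (lP S).
  split=> [|]; last exact: has_weight_zero (lP X).
  case: (l X) / (lP X) => // X' Y S i p n _ _ _ /eqP.
  by rewrite addn_eq0 (gtn_eqF (w_gt0 S)) andbF.
have [a [b [X'a X''b]]] := has_weight_exact (lP X) exip.
by rewrite (has_weight_uniq (lP X') X'a) (has_weight_uniq (lP X'') X''b).
Qed.

End Weight.

(** * Length functions *)

Section Length.
Variables (R : realType) (A : preadditive) (abA : is_abelian A).
Variables (l : A -> R) (lenl : length_function l).
Implicit Types X Y : A.

Lemma length_ge0 X : 0 <= l X. Proof. by case: lenl. Qed.

Lemma length0 X : l X = 0 <-> is_zero X. Proof. by case: lenl. Qed.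

Lemma length_exact X' X X'' (i : hom X' X) (p : hom X X'') :
  short_exact i p -> l X = l X' + l X''.
Proof. by case: lenl => _ _; apply. Qed.

Lemma length_mono X Y (f : hom X Y) : is_mono f -> l X <= l Y.
Proof.
move=> mf; have [C [c exfc]] := mono_short_exact abA mf.
by rewrite (length_exact exfc) lerDl length_ge0.
Qed.

Lemma mono_length_iso X Y (f : hom X Y) : is_mono f -> l Y <= l X -> is_iso f.
Proof.
move=> mf leYX; have [C [c exfc]] := mono_short_exact abA mf.
apply: (mono_epi_iso abA) => //; apply: cokernel_zero_epi (proj2 exfc) _.
apply/length0/eqP; rewrite eq_le length_ge0 andbT.
by move: leYX; rewrite (length_exact exfc) gerDl.
Qed.

Lemma epi_length_iso X Y (f : hom X Y) : is_epi f -> l X <= l Y -> is_iso f.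
Proof.
move=> ef leXY; have [K [k exkf]] := epi_short_exact abA ef.
apply: (mono_epi_iso abA) => //; apply: kernel_zero_mono (proj1 exkf) _.
apply/length0/eqP; rewrite eq_le length_ge0 andbT.
by move: leXY; rewrite (length_exact exkf) gerDr.
Qed.

Lemma length_isomorphic X Y : isomorphic X Y -> l X = l Y.
Proof.
move=> isoXY; have [f /iso_mono/length_mono leXY] := isoXY.
have [g /iso_mono/length_mono leYX] := isomorphic_sym isoXY.
by apply/eqP; rewrite eq_le leXY leYX.
Qed.

Lemma length_epi X Y (f : hom X Y) : is_epi f -> ~ is_mono f -> l Y < l X.
Proof.
by move=> ef nmf; rewrite ltNge; apply/negP => /(epi_length_iso ef)/iso_mono.
Qed.

(** Confines the values of all chains ending in [X] to a finite set, so that maxima exist. A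
    subobject either lies in [X'] or meets it in a subobject with quotient [S]. *)
Lemma subobject_lengths X : finite_length X ->
  exists s : seq R, forall Y (f : hom Y X), is_mono f -> l Y \in s.
Proof.
elim=> [Z Z0|X' Z S i p _ [s sP] exip simS].
  exists [:: 0] => Y f mf; rewrite inE; apply/eqP/length0.
  exact: mono_zero mf Z0.
exists (s ++ [seq x + l S | x <- s]) => Y f mf; rewrite mem_cat.
have [pf0|nz_pf] := EM (p \after f = 0).
  have [g ig] := kernel_lift (proj1 exip) pf0.
  by rewrite (sP _ g) //; apply: (@mono_of_comp _ _ _ _ i); rewrite ig.
apply/orP; right.
have [K [k exk]] := epi_short_exact abA (simple_epi abA simS nz_pf).
have [|g ig] := @kernel_lift _ _ _ _ _ _ _ (f \after k) (proj1 exip).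
  by rewrite compA (exact_comp0 exk).
apply/mapP; exists (l K); last exact: length_exact exk.
apply: (sP _ g); apply: (@mono_of_comp _ _ _ _ i); rewrite ig.
exact: mono_comp mf (exact_mono exk).
Qed.

End Length.

(** * The lexicographic order *)

Section Lexicographic.
Variable R : realType.
Implicit Types A B C V : {fset R}.

Lemma ch_min_le (A : {fset R}) a : a \in A -> (ch_min A <= a%:E)%E.
Proof.
rewrite /ch_min -[a \in A]/(a \in enum_fset A); elim: (enum_fset A) => // x s IH.
rewrite inE big_cons ge_min.
by case/orP => [/eqP->|/IH ->]; rewrite ?lexx ?orbT.
Qed.

Lemma ch_min_attained (A : {fset R}) :
  ch_min A = +oo%E \/ exists2 a, a \in A & ch_min A = a%:E.
Proof.
suff [->|[a]] : ch_min A = +oo%E \/ exists2 a, a \in enum_fset A & ch_min A = a%:E.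
- by left.
- by right; exists a.
rewrite /ch_min; elim: (enum_fset A) => [|x s IH]; first by left; rewrite big_nil.
right; rewrite big_cons.
case: IH => [->|[a sa ->]]; first by exists x; rewrite ?inE ?eqxx // minEle leey.
rewrite -EFin_min; case: (leP x a) => _; first by exists x; rewrite ?inE ?eqxx.
by exists a; rewrite // inE sa orbT.
Qed.

(** Elementwise form of the order; it holds because [ch_min] is attained on nonempty sets and is
    [+oo] on the empty one. *)
Lemma ch_leP A B : ch_le A B <->
  forall a, a \in A -> a \notin B -> exists b, [/\ b \in B, b \notin A & b <= a].
Proof.
rewrite /ch_le; split=> [leAB a Aa nBa|leAB].
  have : (ch_min (B `\` A)%fset <= a%:E)%E.
    by apply: le_trans leAB _; apply: ch_min_le; rewrite in_fsetD nBa.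
  case: (ch_min_attained (B `\` A)%fset) => [->|[b + ->]].
    by rewrite leye_eq.
  by rewrite in_fsetD lee_fin => /andP[nAb Bb] leba; exists b.
case: (ch_min_attained (A `\` B)%fset) => [->|[a + ->]]; first by rewrite leey.
rewrite in_fsetD => /andP[nBa Aa]; have [b [Bb nAb leba]] := leAB a Aa nBa.
apply: (@le_trans _ _ b%:E); last by rewrite lee_fin.
by apply: ch_min_le; rewrite in_fsetD nAb.
Qed.

Lemma ch_le_subset A B : {subset A <= B} -> ch_le A B.
Proof. by move=> sAB; apply/ch_leP => a /sAB ->. Qed.

Lemma fset_least (V : {fset R}) x : x \in V ->
  exists m, [/\ m \in V, m <= x & forall y, y \in V -> m <= y].
Proof.
move=> Vx; case: (ch_min_attained V) => [minV|[m Vm minV]].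
  by have := ch_min_le Vx; rewrite minV leye_eq.
have mP y : y \in V -> m <= y by move/ch_min_le; rewrite minV lee_fin.
by exists m; split; rewrite ?mP.
Qed.

(** At the least element [m] of [D], the first point where the three sets do not all agree,
    membership in [A] implies membership in [B], and that in [C]; so [m] is in [C] but not in
    [A]. *)
Lemma ch_le_trans B A C : ch_le A B -> ch_le B C -> ch_le A C.
Proof.
move=> /ch_leP leAB /ch_leP leBC; apply/ch_leP => a Aa nCa.
pose D := ((A `\` B) `|` (B `\` A) `|` (B `\` C) `|` (C `\` B))%fset.
have DE x : (x \in D) = ((x \in A) != (x \in B)) || ((x \in B) != (x \in C)).
  by rewrite !inE; do 3 case: (x \in _).
have [|m [Dm lema minD]] := @fset_least D a.
  by rewrite DE Aa (negbTE nCa); case: (a \in B).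
have nAB : m \in A -> m \in B.
  move=> Am; apply: contraT => nBm; have [b [Bb nAb lebm]] := leAB m Am nBm.
  have /minD lemb : b \in D by rewrite DE Bb (negbTE nAb).
  by move: nAb; rewrite -(@le_anti _ _ m b) ?Am // lemb lebm.
have nBC : m \in B -> m \in C.
  move=> Bm; apply: contraT => nCm; have [b [Cb nBb lebm]] := leBC m Bm nCm.
  have /minD lemb : b \in D by rewrite DE Cb (negbTE nBb) orbT.
  by move: nBb; rewrite -(@le_anti _ _ m b) ?Bm // lemb lebm.
exists m; move: Dm nAB nBC; rewrite DE.
case: (m \in A); case: (m \in B); case: (m \in C) => //= _ nAB nBC.
all: by [have := nAB isT | have := nBC isT | split].
Qed.

(** The least element of the symmetric difference [D] decides: the set containing it is the larger
    one. *)
Lemma ch_le_total A B : ch_le A B \/ ch_le B A.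
Proof.
pose D := ((A `\` B) `|` (B `\` A))%fset.
have DE x : (x \in D) = ((x \in A) != (x \in B)).
  by rewrite !inE; do 2 case: (x \in _).
have [[x Dx]|noD] := EM (exists x, x \in D); last first.
  left; apply/ch_leP => a Aa nBa; case: noD; exists a.
  by rewrite DE Aa (negbTE nBa).
have [m [Dm _ minD]] := fset_least Dx.
have [Am|nAm] := boolP (m \in A).
  right; apply/ch_leP => b Bb nAb; exists m; split=> //.
    by move: Dm; rewrite DE Am; case: (m \in B).
  by apply: minD; rewrite DE Bb (negbTE nAb).
left; apply/ch_leP => a Aa nBa; exists m; split=> //.
  by move: Dm; rewrite DE (negbTE nAm); case: (m \in B).
by apply: minD; rewrite DE Aa (negbTE nBa).
Qed.

Lemma ch_le_max (P : {fset R} -> Prop) (s : seq {fset R}) V :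
    P V -> (forall W, P W -> W \in s) ->
  exists2 M, P M & forall W, P W -> ch_le W M.
Proof.
move=> PV Ps.
suff [M PM maxM] : exists2 M, P M & forall W, W \in s -> P W -> ch_le W M.
  by exists M => // W PW; apply: maxM => //; apply: Ps.
elim: s {Ps} => [|U s [M PM maxM]]; first by exists V.
have [PU|nPU] := EM (P U); last first.
  by exists M => // W; rewrite inE => /orP[/eqP->|/maxM].
have [leUM|leMU] := ch_le_total U M.
  by exists M => // W; rewrite inE => /orP[/eqP->|/maxM].
exists U => // W; rewrite inE => /orP[/eqP-> _|/maxM leWM /leWM].
  exact: ch_le_subset.
by move/ch_le_trans; apply.
Qed.

End Lexicographic.

(** * Chains and the Gabriel-Roiter measure *)

Section Measure.
Variables (R : realType) (A : preadditive) (abA : is_abelian A).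
Hypothesis fin : forall X : A, finite_length X.
Variables (l : A -> R) (lenl : length_function l).
Implicit Types X Y Z : A.

Lemma mem_chain_set (c : nat -> A) n v :
  reflect (exists2 i, (i <= n)%N & v = l (c i))
          (v \in [fset l (c (val i)) | i in 'I_n.+1]%fset).
Proof.
apply: (iffP idP) => [/imfsetP[i _ ->]|[i lein ->]].
  by exists i => //; apply: (ltn_ord i).
by apply/imfsetP; exists (Ordinal (lein : (i < n.+1)%N)).
Qed.

Lemma ind_chain_mono X n c i j : ind_chain X n c -> (i <= j)%N -> (j <= n)%N ->
  exists f : hom (c i) (c j), is_mono f.
Proof.
case=> _ pr _; elim: j => [|j IH].
  by rewrite leqn0 => /eqP-> _; exists (idm _); apply: mono_idm.
rewrite leq_eqVlt => /predU1P[->|leij] ltjn; first by exists (idm _); apply: mono_idm.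
have [f mf] := IH leij (ltnW ltjn); have [[g mg] _] := pr j ltjn.
by exists (g \after f); apply: mono_comp.
Qed.

Lemma ind_chain_take X n c m : ind_chain X n c -> (m <= n)%N -> ind_chain (c m) m c.
Proof.
case=> ind pr _ lemn; split=> // i leim; first by apply: ind (leq_trans leim lemn).
exact: pr (leq_trans leim lemn).
Qed.

Lemma chain_values1 X : indecomposable X -> chain_values l X [fset l X]%fset.
Proof.
move=> indX; exists 0%N, (fun=> X); split=> //; apply/fsetP => v; rewrite in_fset1.
apply/eqP/mem_chain_set; last by case.
by move=> ->; exists 0%N.
Qed.

Lemma chain_values_le X V v : chain_values l X V -> v \in V -> v <= l X.
Proof.
case=> n [c [ch ->]] /mem_chain_set[i lein ->]; have [_ _ <-] := ch.
by have [f] := ind_chain_mono ch lein (leqnn n); apply: length_mono.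
Qed.

Lemma chain_values_sub X V v : chain_values l X V -> v \in V ->
  exists Y (f : hom Y X), is_mono f /\ v = l Y.
Proof.
case=> n [c [ch ->]] /mem_chain_set[i lein ->]; have [_ _ <-] := ch.
by have [f] := ind_chain_mono ch lein (leqnn n); exists (c i), f.
Qed.

(** [Y] is appended to the chain, unless it is isomorphic to [X]: then it replaces the last term,
    because neighbours in a chain are not isomorphic, and [l X = l Y] keeps the values. *)
Lemma chain_values_extend X Y (f : hom X Y) V :
    chain_values l X V -> is_mono f -> indecomposable Y ->
  chain_values l Y (l Y |` V)%fset.
Proof.
move=> [n [c [[ind pr cn] ->]]] mf indY.
have [isoXY|nisoXY] := EM (isomorphic X Y).
  pose c' i := if (i < n)%N then c i else Y.
  exists n, c'; split.
    rewrite /c'; split=> [i lein|i ltin|]; last by rewrite ltnn.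
      by case: ifP => _ //; apply: ind.
    rewrite ltin; case: ifPn => [_|]; first exact: pr.
    rewrite -leqNgt => leni; have eqi : i.+1 = n by apply/eqP; rewrite eqn_leq ltin.
    have [[g mg] niso] := pr i ltin; move: g mg niso; rewrite eqi cn => g mg niso.
    split; first by exists (f \after g); apply: mono_comp.
    by move/isomorphic_trans/(_ (isomorphic_sym isoXY)).
  apply/fsetP => v; rewrite in_fset1U; apply/idP/mem_chain_set.
    case/predU1P => [->|/mem_chain_set[i lein ->]]; first by exists n; rewrite /c' ?ltnn.
    exists i => //; rewrite /c'; case: ltnP => // leni.
    have -> : i = n by apply/eqP; rewrite eqn_leq lein.
    by rewrite cn; apply: (length_isomorphic abA lenl).
  case=> i lein ->; rewrite /c'; case: ltnP => _; last by rewrite eqxx.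
  by apply/orP; right; apply/mem_chain_set; exists i.
pose c' i := if (i <= n)%N then c i else Y.
exists n.+1, c'; split.
  rewrite /c'; split=> [i lein|i ltin|]; last by rewrite ltnn.
    by case: ifP => [/ind|].
  rewrite -ltnS ltin; case: ifPn => [|]; first exact: pr.
  rewrite -leqNgt => leni; have -> : i = n by apply/eqP; rewrite eqn_leq -ltnS ltin.
  by rewrite cn; split; first by exists f.
apply/fsetP => v; rewrite in_fset1U; apply/idP/mem_chain_set.
  case/predU1P => [->|/mem_chain_set[i lein ->]]; first by exists n.+1; rewrite /c' ?ltnn.
  by exists i; [exact: leqW|rewrite /c' lein].
case=> i lein ->; rewrite /c'; case: leqP => [lein'|_]; last by rewrite eqxx.
by apply/orP; right; apply/mem_chain_set; exists i.
Qed.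

(** All value sets are subsets of one finite set of reals containing the subobject lengths, so a
    maximum exists and [xget] does not fall back on [fset0]. *)
Lemma gr_measureP X : indecomposable X ->
  chain_values l X (gr_measure l X) /\
  forall W, chain_values l X W -> ch_le W (gr_measure l X).
Proof.
move=> indX; have [s sP] := subobject_lengths abA lenl (fin X).
pose F := [fset x | x in s]%fset.
have [|M XM maxM] :=
    @ch_le_max _ (chain_values l X) (enum_fset (fpowerset F)) _ (chain_values1 indX).
  move=> W XW; rewrite -[_ \in _]/(W \in fpowerset F) fpowersetE.
  apply/fsubsetP => v Wv; have [Y [f [mf ->]]] := chain_values_sub XW Wv.
  by rewrite inE; apply: sP mf.
exact: (@xgetPex _ fset0 [set V | chain_values l X V /\
  forall W, chain_values l X W -> ch_le W V]%classic (ex_intro _ M (conj XM maxM))).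
Qed.

Lemma gr_measure_mono X Y (f : hom X Y) :
    is_mono f -> indecomposable X -> indecomposable Y ->
  ch_le (gr_measure l X) (gr_measure l Y).
Proof.
move=> mf /gr_measureP[XV _] indY; have [_ maxY] := gr_measureP indY.
apply: ch_le_trans (maxY _ (chain_values_extend XV mf indY)).
by apply: ch_le_subset => v; rewrite in_fset1U orbC => ->.
Qed.

(** If [l X < l Y], then [l Y] is absent from the measure of [X], and adding it gives a strictly
    larger value set for [Y]. *)
Lemma gr_measure_mono_iso X Y (f : hom X Y) :
    is_mono f -> indecomposable X -> indecomposable Y ->
  ch_le (gr_measure l Y) (gr_measure l X) -> is_iso f.
Proof.
move=> mf /gr_measureP[XV _] indY; have [_ maxY] := gr_measureP indY.
move/(ch_le_trans (maxY _ (chain_values_extend XV mf indY)))/ch_leP/(_ (l Y)) => leYX.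
apply: (mono_length_iso abA lenl) => //; rewrite leNgt; apply/negP => ltXY.
case: leYX => [||b [XVb + _]]; first by rewrite fset1U1.
  by apply/negP => /(chain_values_le XV); rewrite leNgt ltXY.
by rewrite in_fset1U XVb orbT.
Qed.

End Measure.

(** * Inductions on a natural-valued length *)

Section NatLength.
Variables (R : realType) (A : preadditive) (abA : is_abelian A).
Variables (len : A -> nat).
Hypothesis lenP : length_function (fun X => (len X)%:R : R).
Implicit Types X Y Z Q S : A.

(** The values of a general real length function need not be well ordered; a natural-valued [len]
    makes minimal choices possible. *)
Lemma nat_length_min (P : A -> Prop) X : P X ->
  exists2 M, P M & forall Y, P Y -> (len M <= len Y)%N.
Proof.
move: {2}(len X) (leqnn (len X)) => n; elim: n X => [|n IH] X leXn PX.
  by exists X => // Y _; apply: leq_trans leXn _.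
have [[Y PY ltYX]|noY] := EM (exists2 Y, P Y & (len Y < len X)%N).
  by apply: (IH Y) => //; rewrite -ltnS; apply: leq_trans ltYX leXn.
by exists X => // Y PY; rewrite leqNgt; apply/negP => ltYX; apply: noY; exists Y.
Qed.

Lemma nat_length_mono_iso X Y (f : hom X Y) :
  is_mono f -> (len Y <= len X)%N -> is_iso f.
Proof. by move=> mf leYX; apply: (mono_length_iso abA lenP); rewrite ?ler_nat. Qed.

Lemma nat_length_epi_iso X Y (f : hom X Y) :
  is_epi f -> (len X <= len Y)%N -> is_iso f.
Proof. by move=> ef leXY; apply: (epi_length_iso abA lenP); rewrite ?ler_nat. Qed.

(** [Y] is split until it is indecomposable: the two projections of a decomposition cannot both kill
    [g], and a proper summand is shorter. *)
Lemma nonzero_indecomposable_retract W Y (g : hom W Y) : g <> 0 ->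
  exists Z (s : hom Z Y) (p : hom Y Z),
    [/\ indecomposable Z, p \after s = idm Z & p \after g <> 0].
Proof.
have [n] := ubnP (len Y); elim: n => // n IH in Y g *; rewrite ltnS => leYn nz_g.
have [indY|nindY] := EM (indecomposable Y).
  by exists Y, (idm Y), (idm Y); rewrite !comp_idl.
have step X1 X2 (i1 : hom X1 Y) (i2 : hom X2 Y) (p1 : hom Y X1) (p2 : hom Y X2) :
    p1 \after i1 = idm X1 -> p2 \after i2 = idm X2 -> p1 \after i2 = 0 ->
    ~ is_zero X2 -> p1 \after g <> 0 ->
  exists Z (s : hom Z Y) (p : hom Y Z),
    [/\ indecomposable Z, p \after s = idm Z & p \after g <> 0].
  move=> p1i1 p2i2 p1i2 nz2 nz_p1g; have mi1 := split_mono p1i1.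
  have ltX1 : (len X1 < len Y)%N.
    rewrite ltnNge; apply/negP => /(nat_length_mono_iso mi1) isoi1; case: nz2.
    have ip : i1 \after p1 = idm Y.
      by case: (isoi1) => j [ji ij]; rewrite -[p1]comp_idr -ij (compA p1) p1i1 comp_idl.
    by apply/is_zeroP; rewrite -p2i2 -(comp_idl i2) -ip -compA p1i2 !comp0r.
  have [Z [s [p [indZ ps pg]]]] := IH _ (p1 \after g) (leq_trans ltX1 leYn) nz_p1g.
  exists Z, (i1 \after s), (p \after p1); split=> //; last by rewrite -compA.
  by rewrite compA -(compA p) p1i1 comp_idr.
have nzY : ~ is_zero Y.
  by move=> /is_zeroP Y0; apply: nz_g; rewrite -(comp_idl g) Y0 comp0l.
have [X1 [X2 [bip nz1 nz2]]] :
    exists X1 X2, [/\ is_biproduct X1 X2 Y, ~ is_zero X1 & ~ is_zero X2].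
  apply: contrapT => noX; apply: nindY; split=> // X1 X2 bip.
  have [X1_0|nz1] := EM (is_zero X1); first by left.
  have [X2_0|nz2] := EM (is_zero X2); first by right.
  by case: noX; exists X1, X2.
have [i1 [i2 [p1 [p2 [p1i1 p2i2 p1i2 p2i1 idY]]]]] := bip.
have [p1g0|nz_p1g] := EM (p1 \after g = 0); last exact: step p1i1 p2i2 p1i2 nz2 nz_p1g.
apply: (step _ _ i2 i1 p2 p1) => // p2g0; apply: nz_g.
by rewrite -(comp_idl g) -idY compDl -!compA p1g0 p2g0 !comp0r addr0.
Qed.

Lemma simple_subobject X : ~ is_zero X ->
  exists S (f : hom S X), is_simple S /\ is_mono f.
Proof.
move=> nzX.
have [|S [nzS [f mf]] minS] := @nat_length_min
    (fun Y => ~ is_zero Y /\ exists f : hom Y X, is_mono f) X.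
  by split=> //; exists (idm X); apply: mono_idm.
exists S, f; split=> //; split=> // Y g mg.
have [Y0|nzY] := EM (is_zero Y); [by left|right].
apply: nat_length_mono_iso => //; apply: minS; split=> //.
by exists (f \after g); apply: mono_comp.
Qed.

(* Among the factorisations [s \after r] of an endomorphism of Q restricting to
   (id, 0) on Y1 + Y2, one through an object I of least length has
   [r \after s] invertible, because its square is another one. So I is a
   nonzero retract of Q, hence all of Q, and the endomorphism is invertible
   although it kills Y2. *)
Lemma injective_subobject_indecomposable Q Y (j : hom Y Q) :
  injective_object Q -> indecomposable Q -> is_mono j -> ~ is_zero Y -> indecomposable Y.
Proof.
move=> injQ indQ mj nzY; split=> // Y1 Y2 [i1 [i2 [p1 [p2 [p1i1 p2i2 p1i2 _ _]]]]].
have [Y1_0|nz1] := EM (is_zero Y1); [by left|right].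
(* [e] extends the projection of [Y] onto [Y1] to an endomorphism of [Q]; it gives the trivial
   factorisation through [Q] itself. *)
have [e ej] := injQ _ _ _ (j \after i1 \after p1) mj.
pose P I := exists (s : hom I Q) (r : hom Q I),
  s \after r \after j \after i1 = j \after i1 /\ s \after r \after j \after i2 = 0.
have [|I [s [r [srj1 srj2]]] minI] := @nat_length_min P Q.
  exists e, (idm Q); rewrite comp_idr ej -!(compA (j \after i1)) p1i1 p1i2.
  by rewrite comp_idr comp0r.
have [J [a [b [ma eb ab]]]] := image_exists abA (r \after s).
have PJ : P J.
  exists (s \after a), (b \after r); set t := s \after r in srj1 srj2 *.
  have -> : s \after a \after (b \after r) = t \after t.
    by rewrite compA -(compA s) ab !compA.
  rewrite -!(compA t t) -!(compA t (t \after j)) srj1 srj2 comp0r.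
  by rewrite (compA t j).
have isoa : is_iso a by apply: nat_length_mono_iso => //; apply: minI.
have isob : is_iso b by apply: nat_length_epi_iso => //; apply: minI.
have := iso_comp isoa isob; rewrite ab => isors.
have nzI : ~ is_zero I.
  move=> /is_zeroP I0; case: nz1; apply/is_zeroP.
  rewrite -p1i1; suff -> : i1 = 0 by rewrite comp0r.
  by apply: mj; rewrite -srj1 -(comp_idr s) I0 !comp0r !comp0l.
have isos : is_iso s.
  case: (isors) => v [vrs _]; apply: (indecomposable_retract (r := v \after r) abA) => //.
  by rewrite -compA.
have mr : is_mono r.
  case: (isos) => s' [s's ss']; rewrite -(comp_idr r) -ss' compA.
  apply: mono_comp (iso_mono isors) _.
  by apply: (@split_mono _ _ _ _ s).
apply/is_zeroP; rewrite -p2i2; suff -> : i2 = 0 by rewrite comp0r.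
apply: mj; apply: (mono_comp (iso_mono isos) mr).
by rewrite !compA srj2 !comp0r.
Qed.

End NatLength.

(** * Morphisms that are not split monomorphisms *)

Section NonSplit.
Variables (R : realType) (A : preadditive) (abA : is_abelian A).
Hypothesis fin : forall X : A, finite_length X.
Variables (l : A -> R) (lenl : length_function l).
Variables (len : A -> nat).
Hypothesis lenP : length_function (fun X => (len X)%:R : R).
Implicit Types X Y Z Q : A.

Let gr := gr_measure l.

Definition split_monic X Y (f : hom X Y) := exists r : hom Y X, r \after f = idm X.

(* [f'] is the map onto a component of the image of [f]; the measure of its target
   is controlled because the image is a subobject of [Z]. *)
Lemma nonsplit_epi X Z (f : hom X Z) W (g : hom W X) :
    indecomposable X -> indecomposable Z -> ch_le (gr Z) (gr X) ->
    ~ split_monic f -> f \after g <> 0 ->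
  exists Z' (f' : hom X Z'), [/\ indecomposable Z', ch_le (gr Z') (gr X),
    is_epi f', ~ is_mono f' & f' \after g <> 0].
Proof.
move=> indX indZ leZX nsplit nz_fg.
have [I [m [e [mm ee me]]]] := image_exists abA f.
have [|Z' [s [p [indZ' ps peg]]]] :=
    @nonzero_indecomposable_retract R A abA len lenP _ _ (e \after g).
  by move=> eg0; apply: nz_fg; rewrite -me -compA eg0 comp0r.
exists Z', (p \after e); split=> //; last by rewrite -compA.
- apply: ch_le_trans leZX; apply: (gr_measure_mono abA fin lenl) indZ' indZ.
  exact: mono_comp mm (split_mono ps).
- apply: epi_comp ee; apply: (@epi_of_comp _ _ _ _ _ s); rewrite ps.
  by move=> T u v; rewrite !comp_idr.
(* If [p \after e] is mono, so are [e] and [f]; a mono that does not raise the measure is an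
   isomorphism, hence split. *)
move=> /mono_of_comp me_; apply: nsplit.
have mf : is_mono f by rewrite -me; apply: mono_comp.
by have [r [rf _]] := gr_measure_mono_iso abA fin lenl mf indX indZ leZX; exists r.
Qed.

(* If X' is the last but one term of a chain realising the measure of X, then
   [gr Z <= gr X] and [l Z < l X] force [gr Z <= gr X']. *)
Lemma nonsplit_kills X : indecomposable X ->
  exists W (g : hom W X), g <> 0 /\
    forall Z (f : hom X Z), indecomposable Z -> ch_le (gr Z) (gr X) ->
      ~ split_monic f -> f \after g = 0.
Proof.
have [n] := ubnP (len X); elim: n => // n IH in X *; rewrite ltnS => leXn indX.
have [[k [c [ch grX]]] maxX] := gr_measureP abA fin lenl indX.
case: k ch grX => [|k] ch grX.
  (* The measure is the singleton of [l X] here. A nonzero nonsplit map would give a proper nonzero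
     quotient [Z'] of [X]; an indecomposable [Z1] inside its kernel would be shorter than [X], and
     [Z1], [X] would form a chain with a larger value set. *)
  exists X, (idm X); split=> [X0|Z f indZ leZX nsplit].
    by case: indX => nzX _; apply: nzX; apply/is_zeroP.
  apply: contrapT => nz_f.
  have [Z' [f' [[nzZ' _] _ ef' nmf' _]]] := nonsplit_epi indX indZ leZX nsplit nz_f.
  have [K [i exi]] := epi_short_exact abA ef'; have mi := exact_mono exi.
  have [|Z1 [s [p [indZ1 ps _]]]] :=
      @nonzero_indecomposable_retract R A abA len lenP _ _ (idm K).
    by move=> /is_zeroP K0; apply: nmf'; apply: kernel_zero_mono (proj1 exi) K0.
  have ms := split_mono ps.
  have ltZ1X : l Z1 < l X.
    apply: le_lt_trans (length_mono abA lenl ms) _.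
    rewrite (length_exact lenl exi) ltrDl lt_neqAle (length_ge0 lenl) andbT.
    by apply/eqP => /esym/(length0 lenl).
  have := chain_values_extend abA lenl (chain_values1 l indZ1) (mono_comp mi ms) indX.
  move=> /maxX/ch_leP/(_ (l Z1)); rewrite !in_fset1U in_fset1 eqxx orbT.
  case=> //; rewrite grX.
    apply/negP => /(mem_chain_set l c)[j]; rewrite leqn0 => /eqP-> eqZ1.
    by case: ch => _ _ c0; rewrite eqZ1 c0 ltxx in ltZ1X.
  move=> b [/(mem_chain_set l c)[j]]; rewrite leqn0 => /eqP-> ->.
  by case: ch => _ _ ->; rewrite in_fset1U eqxx.
have [ind pr cX] := ch.
have [[x mx] niso] := pr k (ltnSn k); rewrite cX in x mx niso.
have indX' : indecomposable (c k) by apply: ind.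
have ltX' : (len (c k) < len X)%N.
  rewrite ltnNge; apply/negP => /(nat_length_mono_iso abA lenP mx) isox.
  by apply: niso; exists x.
have [W [g [nz_g gP]]] := IH (c k) (leq_trans ltX' leXn) indX'.
(* The witness for the last but one term [c k] is pushed into [X] along the embedding [x]. *)
exists W, (x \after g); split=> [xg0|Z f indZ leZX nsplit].
  by apply: nz_g; apply: mx; rewrite xg0 comp0r.
apply: contrapT => nz_fxg.
have [Z' [f' [indZ' leZ'X ef' nmf' nz_f'xg]]] := nonsplit_epi indX indZ leZX nsplit nz_fxg.
apply: nz_f'xg; rewrite compA; apply: gP => //.
  (* All of [gr Z'] lies below [l X], and every element of [gr X] below [l X] is a value of the
     chain cut at [c k]. *)
  have ltZ'X := length_epi abA lenl ef' nmf'.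
  have [_ maxX'] := gr_measureP abA fin lenl indX'.
  have ck : chain_values l (c k) [fset l (c (val i)) | i in 'I_k.+1]%fset.
    by exists k, c; split=> //; apply: ind_chain_take ch _.
  apply: ch_le_trans (maxX' _ ck); apply/ch_leP => a Z'a nck_a.
  have [Z'V _] := gr_measureP abA fin lenl indZ'.
  have ltaX : a < l X by apply: le_lt_trans ltZ'X; exact: (chain_values_le abA lenl Z'V Z'a).
  have memX b : b \in gr X -> b < l X -> b \in [fset l (c (val i)) | i in 'I_k.+1]%fset.
    rewrite /gr grX => /(mem_chain_set l c)[i leik ->] ltbX.
    apply/(mem_chain_set l c); exists i => //.
    rewrite -ltnS ltn_neqAle leik andbT; apply/eqP => eqi.
    by rewrite eqi cX ltxx in ltbX.
  move/ch_leP/(_ a Z'a): leZ'X => [|b [Xb nZ'b leba]].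
    by apply: contra nck_a => Xa; apply: memX.
  by exists b; split=> //; apply: memX => //; apply: le_lt_trans ltaX.
(* If [f' \after x] split, so would [x], and indecomposability of [X] would make [x] an isomorphism,
   against strictness of the chain. *)
move=> [r rfx]; apply: niso; exists x.
apply: (indecomposable_retract (r := r \after f') abA) => //; last by rewrite -compA.
by case: indX'.
Qed.

Lemma maximal_measure_injective Q : indecomposable Q ->
    (forall X, indecomposable X -> ch_le (gr X) (gr Q)) ->
  injective_object Q.
Proof.
move=> indQ maxQ X Y m f mm.
(* By pushing out, it is enough to split the mono [n]: a retraction of [n] composed with [h] extends
   [f]. *)
have [P [n [h [mn hm]]]] := pushout_mono abA f mm.
have [W [g [nz_g gP]]] := nonsplit_kills indQ.
have [|Z [s [p [indZ ps nz_png]]]] :=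
    @nonzero_indecomposable_retract R A abA len lenP _ _ (n \after g).
  by move=> ng0; apply: nz_g; apply: mn; rewrite ng0 comp0r.
have [[r rpn]|nsplit] := EM (split_monic (p \after n)).
  exists (r \after p \after h); rewrite -compA hm compA -(compA r p n) rpn.
  by rewrite comp_idl.
by case: nz_png; rewrite compA gP //; apply: maxQ.
Qed.

End NonSplit.

(** * A length function adapted to an injective indecomposable object *)

Section Injective.
Variables (R : realType) (A : preadditive) (abA : is_abelian A).
Hypothesis fin : forall X : A, finite_length X.
Implicit Types X Y Q S : A.

Lemma nat_length_function (len : A -> nat) :
    (forall X, len X = 0%N <-> is_zero X) ->
    (forall X' X X'' (i : hom X' X) (p : hom X X''),
        short_exact i p -> len X = (len X' + len X'')%N) ->
  length_function (fun X => (len X)%:R : R).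
Proof.
move=> len0 lenD; split=> [X|X|X' X X'' i p /lenD ->]; last by rewrite natrD.
  exact: ler0n.
by rewrite -len0; split=> [/eqP|->//]; rewrite pnatr_eq0 => /eqP.
Qed.

(** Weight 1 for every simple object gives the composition length. *)
Lemma nat_length_exists :
  exists len : A -> nat, length_function (fun X => (len X)%:R : R).
Proof.
have [len [len0 lenD _]] :=
  @weight_length _ abA (fun=> 1%N) (fun _ _ _ => erefl) fin (fun=> isT).
by exists len; apply: nat_length_function.
Qed.

Lemma injective_maximal_measure Q : indecomposable Q -> injective_object Q ->
  exists l : A -> R, length_function l /\
    forall X, indecomposable X -> ch_le (gr_measure l X) (gr_measure l Q).
Proof.
move=> indQ injQ; have [len lenP] := nat_length_exists.
have [nzQ _] := indQ.
have [S [sQ [simS mS]]] := simple_subobject abA lenP nzQ.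
pose w X := if `[< isomorphic X S >] then 1%N else 2%N.
have w_iso X Y : isomorphic X Y -> w X = w Y.
  move=> isoXY; rewrite /w; congr (if _ then _ else _); apply: asbool_equiv_eq.
  split=> [|isoYS]; last exact: isomorphic_trans isoXY isoYS.
  exact: isomorphic_trans (isomorphic_sym isoXY).
have w_gt0 X : (0 < w X)%N by rewrite /w; case: ifP.
have [k [k0 kD kS]] := weight_length abA w_iso fin w_gt0.
pose l X : R := (k X)%:R; have lenl : length_function l by apply: nat_length_function.
exists l; split=> // X indX.
have [XV _] := gr_measureP abA fin lenl indX.
have [_ maxQ] := gr_measureP abA fin lenl indQ.
suff [W QW leVW] : exists2 W, chain_values l Q W & ch_le (gr_measure l X) W.
  exact: ch_le_trans leVW (maxQ W QW).
move: (gr_measure l X) XV => V [n [c [ch ->]]]; have [ind pr cX] := ch.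
pose emb Y := exists f : hom Y Q, is_mono f.
have chain_at i : (i <= n)%N -> chain_values l (c i) [fset l (c (val j)) | j in 'I_i.+1]%fset.
  by move=> lein; exists i, c; split=> //; apply: ind_chain_take ch lein.
have le_c i j : (i <= j)%N -> (j <= n)%N -> l (c i) <= l (c j).
  by move=> leij lejn; have [f] := ind_chain_mono ch leij lejn; apply: length_mono.
have [allemb|nall] := EM (forall i, (i <= n)%N -> emb (c i)).
  have [f mf] := allemb n (leqnn n).
  exists (l Q |` [fset l (c (val j)) | j in 'I_n.+1])%fset.
    exact: (chain_values_extend abA lenl (chain_at n (leqnn n)) mf indQ).
  by apply: ch_le_subset => v; rewrite in_fset1U orbC => ->.
have exi : exists i, (i <= n)%N && ~~ `[< emb (c i) >].
  apply: contrapT => noi; apply: nall => i lein; apply: contrapT => nemb.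
  by apply: noi; exists i; rewrite lein; apply/asboolPn.
case: (ex_minnP exi) => i /andP[lein /asboolPn nemb] mini {exi nall}.
case: i => [|i] in lein nemb mini *.
  (* The top factor of [c 0] has weight 2, or it is isomorphic to [S] and its kernel is nonzero,
     since otherwise [c 0] would be isomorphic to [S] and embed into [Q]. *)
  have c0_ge2 : 2%:R <= l (c 0%N).
    rewrite /l ler_nat; case: (ind 0%N lein) => nz0 _.
    case: (fin (c 0%N)) nz0 nemb => // Y' Y T i p _ exip simT nzY nemb.
    rewrite (kD _ _ _ _ _ exip) (kS T simT) /w.
    case: asboolP => [isoT|_]; last exact: leq_addl.
    rewrite addn1 ltnS lt0n; apply/eqP => /k0 Y'0; apply: nemb.
    have mp := kernel_zero_mono (proj1 exip) Y'0.
    have [f /iso_mono mf] := isoT.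
    by exists (sQ \after (f \after p)); do 2!apply: mono_comp => //.
  have lS : l S = 1.
    by rewrite /l kS // /w asboolT //; apply: isomorphic_refl.
  (* All values of the given chain exceed [l S = 1], so any value set containing [l S] dominates
     it. *)
  exists (l Q |` [fset l S])%fset.
    exact: (chain_values_extend abA lenl (chain_values1 l (simple_indecomposable simS)) mS indQ).
  apply/ch_leP => a /(mem_chain_set l c)[j lejn ->] _; exists 1.
  have gt1 m : (m <= n)%N -> 1 < l (c m).
    by move=> lemn; apply: lt_le_trans (le_trans c0_ge2 (le_c 0%N m _ lemn)) => //; rewrite ltr1n.
  split; first by rewrite in_fset1U in_fset1 lS eqxx orbT.
    by apply/(mem_chain_set l c) => -[m lemn eq1]; have := gt1 m lemn; rewrite -eq1 ltxx.
  exact: ltW (gt1 j lejn).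
have lein' : (i <= n)%N := ltnW lein.
have [f mf] : emb (c i).
  apply: contrapT => nembi; have /mini : (i <= n)%N && ~~ `[< emb (c i) >].
    by rewrite lein'; apply/asboolPn.
  by rewrite ltnn.
have [[u mu] niso] := pr i lein.
have [e eu] := injQ _ _ u f mu.
have [Y [m [b [mm eb mb]]]] := image_exists abA e.
have nz_ci : ~ is_zero (c i) by case: (ind i lein').
have mbu : is_mono (b \after u).
  by apply: (@mono_of_comp _ _ _ _ m); rewrite compA mb eu.
have indY : indecomposable Y.
  apply: (injective_subobject_indecomposable abA lenP injQ indQ mm) => Y0.
  by apply: nz_ci; apply: mono_zero mbu Y0.
(* Otherwise [b \after u] is invertible, so [u] splits and is an isomorphism onto the indecomposable
   [c i.+1]. *)
have lt_ci_Y : l (c i) < l Y.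
  rewrite ltNge; apply/negP => /(mono_length_iso abA lenl mbu)[v [vbu _]].
  apply: niso; exists u.
  apply: (indecomposable_retract (r := v \after b) abA) => //; last by rewrite -compA.
  exact: ind.
(* If [b] were mono, [m \after b] would embed [c i.+1] into [Q]. *)
have lt_Y_ci : l Y < l (c i.+1).
  apply: (length_epi abA lenl eb) => mb'; apply: nemb; exists (m \after b).
  exact: mono_comp.
have chY := chain_values_extend abA lenl (chain_at i lein') mbu indY.
exists (l Q |` (l Y |` [fset l (c (val j)) | j in 'I_i.+1]))%fset.
  exact: (chain_values_extend abA lenl chY mm indQ).
(* [l Y] falls strictly between the values at [i] and [i.+1], so it is not a value of the given
   chain; a chain value missing from the new set has index above [i], hence exceeds [l Y]. *)
apply/ch_leP => a /(mem_chain_set l c)[j lejn ->] nWa; exists (l Y); split.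
- by rewrite !in_fset1U eqxx orbT.
- apply/(mem_chain_set l c) => -[q leqn eqY]; case: (leqP q i) => [leqi|ltiq].
    by have := le_c q i leqi lein'; rewrite -eqY leNgt lt_ci_Y.
  by have := le_c i.+1 q ltiq leqn; rewrite -eqY leNgt lt_Y_ci.
case: (leqP j i) => [leji|ltij]; last exact: le_trans (ltW lt_Y_ci) (le_c i.+1 j ltij lejn).
by case/negP: nWa; rewrite !in_fset1U; apply/orP; right; apply/orP; right;
   apply/(mem_chain_set l c); exists j.
Qed.

End Injective.

Theorem theorem3p3 (R : realType) (A : preadditive) (hA : abelian_length A)
    (Q : A) (hQ : indecomposable Q) :
  injective_object Q <->
  exists l : A -> R, length_function l /\
    forall X : A, indecomposable X ->
      ch_le (gr_measure l X) (gr_measure l Q).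
Proof.
have [abA fin _] := hA; split; first exact: injective_maximal_measure.
(* The given [l] defines the measure, while the composition length [len] only drives the
   inductions. *)
case=> l [lenl maxQ]; have [len lenP] := nat_length_exists R abA fin.
exact: (maximal_measure_injective abA fin lenl lenP hQ maxQ).
Qed.
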